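(* Assume that $\gamma\geqslant f_y(x,y)$ for all $(x,y)\in[0,1]\times\mathbb{R}$. Then the discrete problem $T\overline{y}=0$ has a unique solution $\overline{y}=(\overline{y}_0,\ldots,\overline{y}_N)^T\in\mathbb{R}^{N+1}$. Moreover, there is a constant $C>0$, independent of $\varepsilon$ and $N$, such that for every $v,w\in\mathbb{R}^{N+1}$ the following stability inequality holds: $$\Vert v-w\Vert\leqslant C\,\Vert Tv-Tw\Vert .$$
   Context: Boundary-value problem: $\varepsilon^2y''-f(x,y)=0$ for $x\in(0,1)$, $y(0)=y(1)=0$, where $\varepsilon\in(0,1)$ is a small perturbation parameter, $f\in C^{k}([0,1]\times\mathbb{R})$ with $k\geqslant 2$, and $f_y:=\partial f/\partial y\geqslant m>0$ on $[0,1]\times\mathbb{R}$ for a constant $m$. Mesh: an arbitrary mesh $0=x_0<x_1<\ldots<x_N=1$, with $h_i=x_{i+1}-x_i$, $i=0,\ldots,N-1$. Parameters of the scheme: $t\in[0,1]$ is a fixed number, $\gamma>0$ is a constant (independent of $\varepsilon$ and $N$), and $\beta=\sqrt{\gamma}/\varepsilon$. Discrete operator: $T:\mathbb{R}^{N+1}\to\mathbb{R}^{N+1}$, $Tu=(Tu_0,Tu_1,\ldots,Tu_N)^T$ for $u=(u_0,\ldots,u_N)^T$, where $Tu_0=-u_0$, $Tu_N=-u_N$, and for $i=1,\ldots,N-1$, writing $f_j=f(x_j,u_j)$, $$Tu_i=\frac{\gamma}{\frac{\cosh(\beta h_{i-1})-1}{\sinh(\beta h_{i-1})}+\frac{\cosh(\beta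 h_i)-1}{\sinh(\beta h_i)}}\Big[\tfrac{(1-t)\cosh(\beta h_{i-1})+t}{\sinh(\beta h_{i-1})}(u_{i-1}-u_i)-\tfrac{(1-t)\cosh(\beta h_i)+t}{\sinh(\beta h_i)}(u_i-u_{i+1})$$ $$-\tfrac{(1-t)f_{i-1}+tf_i}{\gamma}\cdot\tfrac{\cosh(\beta h_{i-1})-1}{\sinh(\beta h_{i-1})}-\tfrac{tf_i+(1-t)f_{i+1}}{\gamma}\cdot\tfrac{\cosh(\beta h_i)-1}{\sinh(\beta h_i)}\Big].$$ $\Vert\cdot\Vert$ is the maximum norm on $\mathbb{R}^{N+1}$. *)

(* Defs.v *)
From HB Require Import structures.
From mathcomp Require Import all_boot all_order all_algebra.
From mathcomp Require Import all_classical all_reals all_analysis.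
Set Implicit Arguments.
Unset Strict Implicit.
Unset Printing Implicit Defensive.
Import Order.TTheory GRing.Theory Num.Theory.
Import numFieldNormedType.Exports.
Local Open Scope classical_set_scope.
Local Open Scope ring_scope.

Definition cosh (R : realType) (z : R) : R := (expR z + expR (- z)) / 2.
Definition sinh (R : realType) (z : R) : R := (expR z - expR (- z)) / 2.

Definition strip (R : realType) : set (R * R) := `[0, 1]%classic `*` setT.

(* The difference quotient in x is taken within [0, 1], so that the derivative
   is one-sided at x = 0 and x = 1; values of f off the strip are irrelevant. *)
Definition is_partial_x (R : realType) (f g : R -> R -> R) : Prop :=
  forall x y : R, x \in `[0, 1] ->
    (f z y - f x y) / (z - x) @[z --> within `[0, 1]%classic x^'] --> g x y.

Definition is_partial_y (R : realType) (f g : R -> R -> R) : Prop :=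
  forall x y : R, x \in `[0, 1] -> is_derive y 1 (f x) (g x y).

Fixpoint Ck_strip (R : realType) (k : nat) (f : R -> R -> R) : Prop :=
  {within @strip R, continuous (fun p : R * R => f p.1 p.2)} /\
  match k with
  | 0%N => True
  | k'.+1 => exists fx fy : R -> R -> R,
      [/\ is_partial_x f fx, is_partial_y f fy, Ck_strip k' fx & Ck_strip k' fy]
  end.

Definition is_mesh (R : realType) (N : nat) (x : 'cV[R]_N.+1) : Prop :=
  [/\ x ord0 0 = 0, x ord_max 0 = 1 &
      forall i : nat, (i < N)%N -> x (inord i) 0 < x (inord i.+1) 0].

Definition scheme_interior (R : realType) (f : R -> R -> R) (gamma t eps : R)
    (N : nat) (x v : 'cV[R]_N.+1) (i : nat) : R :=
  let beta := Num.sqrt gamma / eps in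
  let h (j : nat) : R := x (inord j.+1) 0 - x (inord j) 0 in
  let a (j : nat) : R :=
    ((1 - t) * cosh (beta * h j) + t) / sinh (beta * h j) in
  let d (j : nat) : R := (cosh (beta * h j) - 1) / sinh (beta * h j) in
  let u (j : nat) : R := v (inord j) 0 in
  let F (j : nat) : R := f (x (inord j) 0) (u j) in
  gamma / (d i.-1 + d i) *
  (a i.-1 * (u i.-1 - u i) - a i * (u i - u i.+1)
   - ((1 - t) * F i.-1 + t * F i) / gamma * d i.-1
   - (t * F i + (1 - t) * F i.+1) / gamma * d i).

Definition scheme (R : realType) (f : R -> R -> R) (gamma t eps : R)
    (N : nat) (x v : 'cV[R]_N.+1) : 'cV[R]_N.+1 :=
  \col_(i < N.+1)
    if (i == 0 :> nat) || (i == N :> nat) then - v i 0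
    else scheme_interior f gamma t eps x v i.

(* Main.v *)
(* In each row, a mean value theorem turns Tv - Tw into a linear
   form in z = v - w whose off-diagonal coefficients are nonnegative; this is
   where gamma >= f_y enters, through (1 - t) cosh + t - (1 - t) (cosh - 1) = 1.
   The row sums are at most -c with c = min m 1.  Hence, once the step l is
   small with respect to the mesh, u |-> u + l Tu contracts the maximum norm by
   the factor 1 - l c.  The Banach fixed point theorem gives existence, and the
   reverse triangle inequality applied to z + l (Tv - Tw) gives stability with
   the constant 1 / c, from which the step l has disappeared. *)
Require Import Defs.
From HB Require Import structures.
From mathcomp Require Import all_boot all_order all_algebra.
From mathcomp Require Import all_classical all_reals all_analysis.
From mathcomp Require Import ring lra.
Set Implicit Arguments.
Unset Strict Implicit.
Unset Printing Implicit Defensive.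
Import Order.TTheory GRing.Theory Num.Theory.
Import numFieldNormedType.Exports.
Local Open Scope classical_set_scope.
Local Open Scope ring_scope.

(** Makes column vectors a complete normed module, the space in which the fixed point theorem is
    applied. *)
HB.instance Definition _ (R : realType) m n := Complete.on 'M[R]_(m, n).

Lemma cosh_gt1_sinh_gt0 (R : realType) (z : R) : 0 < z ->
  1 < cosh z /\ 0 < sinh z.
Proof.
move=> z0; rewrite /cosh /sinh expRN.
have E1 : 1 < expR z by rewrite expR_gt1.
have E0 : 0 < expR z by rewrite expR_gt0.
have V0 : 0 < (expR z)^-1 by rewrite invr_gt0.
have EV : expR z * (expR z)^-1 = 1 by rewrite divff// gt_eqF.
(* This product is 2 (cosh z - 1), so its positivity gives 1 < cosh z. *)
have sq : 0 < (expR z - 1) ^+ 2 * (expR z)^-1.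
  by rewrite mulr_gt0// exprn_gt0// subr_gt0.
have eq : (expR z - 1) ^+ 2 * (expR z)^-1 = expR z + (expR z)^-1 - 2.
  rewrite (_ : _ * _ = (expR z - 2) * (expR z * (expR z)^-1) + (expR z)^-1).
    by rewrite EV; ring.
  by ring.
have V1 : (expR z)^-1 < 1 by rewrite invf_lt1.
by split; lra.
Qed.

Lemma secant_slope (R : realType) (f : R -> R) (m M : R) :
  (forall y, derivable f y 1) -> (forall y, m <= derive1 f y <= M) ->
  forall a b, exists2 q, m <= q <= M & f a - f b = q * (a - b).
Proof.
move=> df bf.
have slope a b : a <= b -> exists2 q, m <= q <= M & f b - f a = q * (b - a).
  move=> ab.
  have [||c _ ->] := @MVT_segment R f (derive1 f) a b ab.
  - by move=> x _; rewrite derive1E; apply/derivableP.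
  - by apply: derivable_within_continuous.
  - by exists (derive1 f c).
move=> a b; have [ab|/ltW ba] := leP a b; last exact: slope.
have [q qb e] := slope _ _ ab; exists q => //.
by rewrite -opprB e -mulrN opprB.
Qed.

Lemma cV_norm_entry (R : realType) n (v : 'cV[R]_n) i : `|v i 0| <= `|v|.
Proof.
rewrite [leRHS]/Num.norm /= mx_normrE.
exact: (le_bigmax _ (fun ij : 'I_n * 'I_1 => `|v ij.1 ij.2|) (i, 0)).
Qed.

Lemma cV_norm_le (R : realType) n (v : 'cV[R]_n) (c : R) : 0 <= c ->
  (forall i, `|v i 0| <= c) -> `|v| <= c.
Proof.
move=> c0 vc; rewrite [leLHS]/Num.norm /= mx_normrE.
by apply/bigmax_leP; split=> // -[i j] _ /=; rewrite (ord1 j).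
Qed.

Lemma mesh_nondecreasing (R : realType) N (x : 'cV[R]_N.+1) : is_mesh x ->
  forall i j, (i <= j)%N -> (j <= N)%N -> x (inord i) 0 <= x (inord j) 0.
Proof.
move=> [_ _ xlt] i; elim=> [|j IH]; first by rewrite leqn0 => /eqP ->.
rewrite leq_eqVlt => /predU1P[-> //|ij] jN.
by rewrite (le_trans (IH _ (ltnW jN)))// ltW// xlt.
Qed.

Lemma mesh_in01 (R : realType) N (x : 'cV[R]_N.+1) : is_mesh x ->
  forall i, (i <= N)%N -> x (inord i) 0 \in `[0, 1].
Proof.
move=> mx i iN; have [x0 x1 _] := mx; rewrite in_itv /=.
rewrite -x0 -x1 (_ : ord0 = inord 0); last by apply/val_inj; rewrite /= inordK.
rewrite (_ : ord_max = inord N); last by apply/val_inj; rewrite /= inordK.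
by rewrite !mesh_nondecreasing.
Qed.

(** Here [z0], [z1], [z2] stand for entries of v - w at three consecutive nodes and [q0], [q1], [q2]
    for secant slopes of f there. The slopes depend on v and w, but the upper bound on [D] does not
    contain them, so one step can serve all pairs v, w. *)
Lemma row_coefficients (R : realFieldType)
    (m g t a1 a2 d1 d2 q0 q1 q2 z0 z1 z2 : R) :
  0 < g -> 0 <= t <= 1 -> 0 < d1 -> 0 < d2 ->
  (1 - t) * d1 <= a1 -> (1 - t) * d2 <= a2 ->
  m <= q0 <= g -> m <= q1 <= g -> m <= q2 <= g ->
  exists A B D : R,
    [/\ 0 <= A, 0 <= B, A + B + m <= D, D <= g / (d1 + d2) * (a1 + a2) + g &
        g / (d1 + d2) *
          (a1 * (z0 - z1) - a2 * (z1 - z2)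
           - ((1 - t) * (q0 * z0) + t * (q1 * z1)) / g * d1
           - (t * (q1 * z1) + (1 - t) * (q2 * z2)) / g * d2)
        = A * z0 + B * z2 - D * z1].
Proof.
move=> g0 /andP[t0 t1] d10 d20 a1d a2d /andP[mq0 q0g] /andP[mq1 q1g]
  /andP[mq2 q2g].
have s0 : 0 < d1 + d2 by rewrite addr_gt0.
have s_neq0 : d1 + d2 != 0 by rewrite gt_eqF.
have g_neq0 : g != 0 by rewrite gt_eqF.
(* g a >= g (1 - t) d >= q (1 - t) d, the last inequality because q <= g. *)
have off (a d q : R) : 0 < d -> (1 - t) * d <= a -> q <= g ->
    0 <= (g * a - (1 - t) * q * d) / (d1 + d2).
  move=> d0 ad qg; rewrite divr_ge0 ?(ltW s0)// subr_ge0.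
  apply: le_trans (_ : g * ((1 - t) * d) <= _); last by rewrite ler_pM2l.
  have : 0 <= (1 - t) * d * (g - q) by rewrite !mulr_ge0 ?subr_ge0// ltW.
  by lra.
exists ((g * a1 - (1 - t) * q0 * d1) / (d1 + d2)).
exists ((g * a2 - (1 - t) * q2 * d2) / (d1 + d2)).
exists (g / (d1 + d2) * (a1 + a2) + t * q1).
split; [exact: off|exact: off| | |by field; rewrite s_neq0].
- rewrite -subr_ge0.
  (* In D - A - B the terms with [a1] and [a2] cancel. What remains is an average of the three
     slopes with weights (1 - t) d1 / (d1 + d2), t and (1 - t) d2 / (d1 + d2), hence at least
     [m]. *)
  rewrite [leRHS](_ : _ =
      ((1 - t) * ((q0 - m) * d1 + (q2 - m) * d2)) / (d1 + d2) + t * (q1 - m)).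
    apply: addr_ge0; last by rewrite mulr_ge0 ?subr_ge0.
    rewrite divr_ge0 ?(ltW s0)// mulr_ge0 ?subr_ge0// addr_ge0//.
      by rewrite mulr_ge0 ?subr_ge0// ltW.
    by rewrite mulr_ge0 ?subr_ge0// ltW.
  by field.
- rewrite lerD2l; have : 0 <= t * (g - q1) by rewrite mulr_ge0// subr_ge0.
  have : 0 <= (1 - t) * g by rewrite mulr_ge0 ?subr_ge0// ltW.
  by lra.
Qed.

(** Since l D <= 1, the weights 1 - l D, l A and l B of [z1], [z0] and [z2] are all nonnegative, and
    their sum is at most 1 - l m. *)
Lemma row_contraction (R : realFieldType) (m l A B D z0 z1 z2 Z : R) :
  0 < l -> 0 <= A -> 0 <= B -> A + B + m <= D -> l * D <= 1 ->
  `|z0| <= Z -> `|z1| <= Z -> `|z2| <= Z ->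
  `|z1 + l * (A * z0 + B * z2 - D * z1)| <= (1 - l * m) * Z.
Proof.
move=> l0 A0 B0 ABD lD z0Z z1Z z2Z.
rewrite [X in `|X|](_ : _ = (1 - l * D) * z1 + l * A * z0 + l * B * z2);
  last by ring.
have lA : 0 <= l * A by rewrite mulr_ge0 // ltW.
have lB : 0 <= l * B by rewrite mulr_ge0 // ltW.
have lD' : 0 <= 1 - l * D by rewrite subr_ge0.
apply: (@le_trans _ _ ((1 - l * D) * Z + l * A * Z + l * B * Z)).
  rewrite (le_trans (ler_normD _ _))// lerD//.
    rewrite (le_trans (ler_normD _ _))// lerD//.
      by rewrite normrM ger0_norm// ler_wpM2l.
    by rewrite normrM ger0_norm// ler_wpM2l.
  by rewrite normrM ger0_norm// ler_wpM2l.
rewrite -!mulrDl ler_wpM2r ?(le_trans _ z1Z)//.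
by move: (ler_wpM2l (ltW l0) ABD); rewrite !mulrDr; lra.
Qed.

Lemma relaxation_contraction (R : realType) (f : R -> R -> R)
    (m gamma t eps : R) (N : nat) (x : 'cV[R]_N.+1) :
  (forall z a b, z \in `[0, 1] ->
     exists2 q, m <= q <= gamma & f z a - f z b = q * (a - b)) ->
  0 < gamma -> 0 <= t <= 1 -> 0 < eps -> is_mesh x ->
  exists2 l, 0 < l <= 1 & forall v w : 'cV[R]_N.+1,
    `|v - w + l *: (scheme f gamma t eps x v - scheme f gamma t eps x w)|
    <= (1 - l * Num.min m 1) * `|v - w|.
Proof.
move=> fslope g0 t01 e0 mx; have [t0 t1] := andP t01.
pose h (j : nat) := Num.sqrt gamma / eps * (x (inord j.+1) 0 - x (inord j) 0).
pose a (j : nat) := ((1 - t) * cosh (h j) + t) / sinh (h j).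
pose d (j : nat) := (cosh (h j) - 1) / sinh (h j).
have h_gt0 j : (j < N)%N -> 0 < h j.
  move=> jN; rewrite mulr_gt0 ?divr_gt0 ?sqrtr_gt0// subr_gt0.
  by case: mx => _ _; exact.
have d_gt0 j : (j < N)%N -> 0 < d j.
  by move=> /h_gt0/cosh_gt1_sinh_gt0[c1 s0]; rewrite divr_gt0// subr_gt0.
have d_le_a j : (j < N)%N -> (1 - t) * d j <= a j.
  move=> /h_gt0/cosh_gt1_sinh_gt0[c1 s0].
  by rewrite mulrA ler_wpM2r ?invr_ge0 ?(ltW s0)//; lra.
pose K (i : nat) := gamma / (d i.-1 + d i) * (a i.-1 + a i) + gamma.
have K_ge0 i : (0 < i)%N -> (i < N)%N -> 0 <= K i.
  case: i => // i _ iN /=; have iN' := ltnW iN.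
  have a_ge0 j : (j < N)%N -> 0 <= a j.
    move=> jN; rewrite (le_trans _ (d_le_a j jN))// mulr_ge0 ?subr_ge0//.
    exact/ltW/d_gt0.
  rewrite addr_ge0 ?(ltW g0)// mulr_ge0 ?addr_ge0 ?a_ge0// divr_ge0 ?(ltW g0)//.
  by rewrite addr_ge0// ltW// d_gt0.
(* The terms are nonnegative, so [S] dominates every [K i], hence every diagonal coefficient [D].
   The summand 1 ensures that the step 1 / S is at most 1, as the boundary rows require. *)
pose S := 1 + \sum_(i < N.+1 | (0 < i)%N && (i < N)%N) K i.
have S_ge1 : 1 <= S by rewrite lerDl sumr_ge0// => i /andP[? ?]; rewrite K_ge0.
have S_gt0 : 0 < S by rewrite (lt_le_trans _ S_ge1).
exists S^-1; first by rewrite invr_gt0 S_gt0 invf_le1.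
move=> v w; set l := S^-1; set Z := `|v - w|.
have l_gt0 : 0 < l by rewrite invr_gt0.
have l_le1 : l <= 1 by rewrite invf_le1.
have lm1 : l * Num.min m 1 <= l
  by rewrite ler_piMr ?(ltW l_gt0)// ge_min lexx orbT.
apply: cV_norm_le => [|i].
  by rewrite mulr_ge0 ?normr_ge0// subr_ge0 (le_trans lm1).
have zZ j : `|v (inord j) 0 - w (inord j) 0| <= Z.
  by have := cV_norm_entry (v - w) (inord j); rewrite !mxE.
rewrite !mxE; have [bi|/norP[i0 iN]] := ifPn.
  (* On a boundary row Tu = -u, so the factor is 1 - l; the 1 in [Num.min m 1] accounts for these
     rows. *)
  rewrite [X in `|X|](_ : _ = (1 - l) * (v i 0 - w i 0)); last by ring.
  rewrite normrM ger0_norm ?subr_ge0// ler_pM ?subr_ge0 ?lerD2l ?lerN2//.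
  by move: (zZ i); rewrite inord_val.
have {}i0 : (0 < i)%N by rewrite lt0n.
have {}iN : (i < N)%N by rewrite ltn_neqAle iN -ltnS ltn_ord.
have iN1 : (i.-1 < N)%N by rewrite (leq_ltn_trans (leq_pred i)).
have slope j : (j <= N)%N ->
    exists2 q, m <= q <= gamma & f (x (inord j) 0) (v (inord j) 0) -
      f (x (inord j) 0) (w (inord j) 0) = q * (v (inord j) 0 - w (inord j) 0).
  by move=> jN; apply/fslope/mesh_in01.
have [q0 q0b f0] := slope i.-1 (ltnW iN1).
have [q1 q1b e1] := slope i (ltnW iN).
have [q2 q2b e2] := slope i.+1 iN.
have [A [B [D [A0 B0 ABD DK row]]]] := row_coefficients
  (v (inord i.-1) 0 - w (inord i.-1) 0) (v (inord i) 0 - w (inord i) 0)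
  (v (inord i.+1) 0 - w (inord i.+1) 0) g0 t01 (d_gt0 _ iN1) (d_gt0 _ iN)
  (d_le_a _ iN1) (d_le_a _ iN) q0b q1b q2b.
rewrite (_ : _ - scheme_interior _ _ _ _ _ w _ =
    A * (v (inord i.-1) 0 - w (inord i.-1) 0) +
    B * (v (inord i.+1) 0 - w (inord i.+1) 0) -
    D * (v (inord i) 0 - w (inord i) 0)); last first.
  rewrite -row -f0 -e1 -e2 /scheme_interior /=.
  by rewrite -/(h i) -/(h i.-1) -/(a i) -/(a i.-1) -/(d i) -/(d i.-1); ring.
have lD : l * D <= 1.
  (* D <= K i <= S: the term [K i] is split off the sum and the rest is nonnegative. *)
  rewrite /l ler_pdivrMl// mulr1 (le_trans DK)// -/(K i).
  rewrite /S (bigD1 i) ?i0//= addrCA lerDl addr_ge0// sumr_ge0// => j.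
  by move=> /andP[/andP[? ?] _]; rewrite K_ge0.
have := row_contraction l_gt0 A0 B0 _ lD (zZ i.-1) (zZ i) (zZ i.+1).
rewrite inord_val; apply; apply: le_trans ABD.
by rewrite lerD2l ge_min lexx.
Qed.

Lemma contraction_fixpoint (R : realType) (X : completeNormedModType R)
    (F : X -> X) (q : R) : 0 <= q < 1 ->
  (forall u v, `|F u - F v| <= q * `|u - v|) -> exists p, F p = p.
Proof.
move=> /andP[q0 q1] Fq.
(* The Banach theorem concerns self-maps of a closed nonempty set; here that set is the whole
   space. *)
pose G : {fun [set: X] >-> [set: X]} := HB.pack F
  (isFun.Build _ _ [set: X] [set: X] F (fun _ _ => I)).
have [|||p _ pG] := @banach_fixed_point R X [set: X] G.
- exists (NngNum q0); split=> //= -[u v] _ /=; exact: Fq.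
- exact: closedT.
- by exists 0.
- by exists p; rewrite [RHS]pG.
Qed.

Theorem theorem4p1 (R : realType) (k : nat) (f : R -> R -> R) (m gamma t : R)
  (hk : (2 <= k)%N) (hf : Ck_strip k f) (hm : 0 < m)
  (hfy : forall x y : R, x \in `[0, 1] -> m <= derive1 (f x) y)
  (ht : t \in `[0, 1]) (hgamma : 0 < gamma)
  (hgamma_fy : forall x y : R, x \in `[0, 1] -> derive1 (f x) y <= gamma) :
  (forall (eps : R) (N : nat) (x : 'cV[R]_N.+1),
     0 < eps < 1 -> is_mesh x ->
     exists! y : 'cV[R]_N.+1, scheme f gamma t eps x y = 0) /\
  (exists2 C : R, 0 < C &
     forall (eps : R) (N : nat) (x : 'cV[R]_N.+1),
       0 < eps < 1 -> is_mesh x ->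
       forall v w : 'cV[R]_N.+1,
         `|v - w| <= C * `|scheme f gamma t eps x v - scheme f gamma t eps x w|).
Proof.
have fslope z a b : z \in `[0, 1] ->
    exists2 q, m <= q <= gamma & f z a - f z b = q * (a - b).
  move=> z01; apply: secant_slope => y; last by rewrite hfy//= hgamma_fy.
  (* Differentiability in y is read off the first layer of [Ck_strip]. *)
  case: k hk hf => // k' _ [_ [fx [fy [_ fyP _ _]]]].
  by have [] := fyP z y z01.
have c_gt0 : 0 < Num.min m 1 by rewrite lt_min hm ltr01.
have relax eps N (x : 'cV[R]_N.+1) (eps01 : 0 < eps < 1) (mx : is_mesh x) :=
  relaxation_contraction fslope hgamma ht (proj1 (andP eps01)) mx.
have stable eps N (x : 'cV[R]_N.+1) : 0 < eps < 1 -> is_mesh x ->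
    forall v w, `|v - w| <= (Num.min m 1)^-1 *
      `|scheme f gamma t eps x v - scheme f gamma t eps x w|.
  move=> eps01 mx v w; have [l /andP[l0 l1] /(_ v w)] := relax _ _ _ eps01 mx.
  set T := (X in l *: X) => contr; rewrite ler_pdivlMl// -(ler_pM2l l0).
  (* With z = v - w and c = min m 1: |z| <= |z + l T| + l |T| <= (1 - l c) |z| + l |T|, hence l c
     |z| <= l |T|. The goal was multiplied by [l] beforehand to match. *)
  have := ler_normB (v - w + l *: T) (l *: T); rewrite addrK normrZ gtr0_norm//.
  by lra.
split; last by exists (Num.min m 1)^-1; rewrite ?invr_gt0.
move=> eps N x eps01 mx; have [l /andP[l0 l1] contr] := relax _ _ _ eps01 mx.
have [|v w|y yE] := @contraction_fixpoint _ _
    (fun v => v + l *: scheme f gamma t eps x v) (1 - l * Num.min m 1).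
- rewrite subr_ge0 gtrBl mulr_gt0// andbT.
  by rewrite (le_trans _ l1)// ler_piMr ?(ltW l0)// ge_min lexx orbT.
- by rewrite opprD addrACA -scalerBr.
have y0 : scheme f gamma t eps x y = 0.
  have /eqP := yE; rewrite -subr_eq0 addrAC subrr add0r scaler_eq0 gt_eqF//=.
  by move/eqP.
(* Uniqueness is the stability inequality for two vectors that the scheme sends to 0. *)
exists y; split=> // w w0; apply/eqP; rewrite -subr_eq0 -normr_le0.
by rewrite (le_trans (stable _ _ _ eps01 mx _ _))// y0 w0 subrr normr0 mulr0.
Qed.
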